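(* Let $n,m\ge 1$ and $s\in(0,n)$ be integers and let $f\colon\mathbb{R}^n\to\mathbb{R}$ be of class $C^1$. Assume that $\phi(x)=Ax+b$ is an affine mapping, where $A\in\mathbb{R}^{m\times n}$ and $b\in\mathbb{R}^m$, that $D\subset\mathbb{R}^m$ is a closed and convex cone, and put $\Phi=\phi^{-1}(D)$, $\mathcal S=\{x\in\mathbb{R}^n:\|x\|_0\le s\}$, $\Omega=\Phi\cap\mathcal S$. Assume that $0\neq\bar x\in\Omega$ is a local optimal solution of the problem of minimizing $f$ over $\Omega$, and that $f$ is of class $C^{1,1}$ around $\bar x$. Then for each $u\in\mathcal R_\Phi(\bar x)\cap T_{\mathcal S}(\bar x)\cap\ker\nabla f(\bar x)$ there exists $z\in\partial^2f(\bar x)(u)$ such that $\langle z,u\rangle\ge0$.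
   Context: Notation: $\|x\|_0$ is the number of nonzero components of $x$; $\ker\nabla f(\bar x)=\{u:\langle\nabla f(\bar x),u\rangle=0\}$. $\bar x\in\Omega$ is a local optimal solution if there is a neighborhood $U$ of $\bar x$ with $f(x)\ge f(\bar x)$ for all $x\in\Omega\cap U$. A real function is of class $C^{1,1}$ around $\bar x$ if on some open neighborhood of $\bar x$ it is Fréchet differentiable with locally Lipschitz gradient. For $X\subset\mathbb{R}^n$ and $\bar x\in X$, the contingent cone is $T_X(\bar x)=\{u:\exists t_k\to0^+,\ \exists u_k\to u,\ \bar x+t_ku_k\in X\ \forall k\}$ and the radial tangent cone is $\mathcal R_X(\bar x)=\{u:\exists\tau>0,\ \bar x+tu\in X\ \forall t\in[0,\tau]\}$. The Fréchet normal cone is $\widehat N_X(\bar x)=\{v:\limsup_{x\to\bar x,\,x\in X}\langle v,x-\bar x\rangle/\|x-\bar x\|\le0\}$, and the limiting normal cone $N_X(\bar x)$ is the set of all limits of sequences $v_k\in\widehat N_X(x_k)$ with $x_k\to\bar x$, $x_k\in X$. For $\psi$ of class $C^{1,1}$ around $\bar x$, the limiting (Mordukhovich) second-order subdifferential is $\partial^2\psi(\bar x)(u)=\{w\in\mathbb{R}^n:(w,-u)\in N_{\mathrm{gph}\,\nabla\psi}(\bar x,\nabla\psi(\bar x))\}$, which equals $\partial\langle u,\nabla\psi\rangle(\bar x)$, where $\partial\varphi(\bar x)=\{v:(v,-1)\in N_{\mathrm{epi}\,\varphi}(\bar x,\varphi(\bar x))\}$ is the limiting subdifferential. *)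

(* Defs.v *)
From HB Require Import structures.
From mathcomp Require Import all_boot all_order all_algebra.
From mathcomp Require Import all_classical all_reals all_analysis.
Import Order.TTheory GRing.Theory Num.Theory numFieldNormedType.Exports.

Set Implicit Arguments.
Unset Strict Implicit.
Unset Printing Implicit Defensive.

Local Open Scope classical_set_scope.
Local Open Scope ring_scope.

Definition dot (R : realType) (n : nat) (u v : 'cV[R]_n) : R :=
  \sum_(i < n) u i 0 * v i 0.

(* The library norm on matrices is the max norm; it induces the same topology. *)
Definition enorm (R : realType) (n : nat) (u : 'cV[R]_n) : R :=
  Num.sqrt (dot u u).

Definition norm0 (R : realType) (n : nat) (x : 'cV[R]_n) : nat :=
  #|[pred i : 'I_n | x i 0 != 0]|.

Definition sparse (R : realType) (n s : nat) : set 'cV[R]_n :=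
  [set x | (norm0 x <= s)%N].

(* Meaningful where f is differentiable; the entries are partial derivatives. *)
Definition gradient (R : realType) (n : nat) (f : 'cV[R]_n -> R)
    (x : 'cV[R]_n) : 'cV[R]_n :=
  \col_(i < n) 'D_(delta_mx i 0) f x.

Definition class_C1 (R : realType) (n : nat) (f : 'cV[R]_n -> R) : Prop :=
  (forall x, differentiable f x) /\ continuous (gradient f).

Definition class_C11_around (R : realType) (n : nat) (f : 'cV[R]_n -> R)
    (xbar : 'cV[R]_n) : Prop :=
  exists U : set 'cV[R]_n,
    [/\ open U, U xbar,
        forall x, U x -> differentiable f x &
        forall x, U x ->
          exists2 V, nbhs x V & [lipschitz (gradient f y) | y in V]].

Definition cone (R : realType) (m : nat) (D : set 'cV[R]_m) : Prop :=
  forall (t : R) (y : 'cV[R]_m), 0 < t -> D y -> D (t *: y).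

Definition local_optimal_solution (R : realType) (n : nat)
    (f : 'cV[R]_n -> R) (Omega : set 'cV[R]_n) (xbar : 'cV[R]_n) : Prop :=
  Omega xbar /\ \forall x \near xbar, Omega x -> f xbar <= f x.

Definition contingent_cone (R : realType) (n : nat) (X : set 'cV[R]_n)
    (xbar : 'cV[R]_n) : set 'cV[R]_n :=
  [set u | exists (t : nat -> R) (v : nat -> 'cV[R]_n),
     [/\ forall k, 0 < t k, t @ \oo --> (0 : R), v @ \oo --> u &
         forall k, X (xbar + t k *: v k)]].

Definition radial_cone (R : realType) (n : nat) (X : set 'cV[R]_n)
    (xbar : 'cV[R]_n) : set 'cV[R]_n :=
  [set u | exists2 tau : R, 0 < tau &
     forall t : R, 0 <= t <= tau -> X (xbar + t *: u)].

(* The limit superior is taken over x in X tending to xbar with x != xbar; it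
   is -oo when xbar is isolated in X, and every v is then a normal. *)
Definition frechet_normal_cone (R : realType) (n : nat) (X : set 'cV[R]_n)
    (xbar : 'cV[R]_n) : set 'cV[R]_n :=
  [set v | (limf_esup
              (fun x : 'cV[R]_n => (dot v (x - xbar) / enorm (x - xbar))%:E)
              (within X (xbar^')) <= 0)%E].

Definition limiting_normal_cone (R : realType) (n : nat) (X : set 'cV[R]_n)
    (xbar : 'cV[R]_n) : set 'cV[R]_n :=
  [set v | exists (x w : nat -> 'cV[R]_n),
     [/\ forall k, X (x k), x @ \oo --> xbar,
         forall k, frechet_normal_cone X (x k) (w k) & w @ \oo --> v]].

(* R^n x R^p is identified with R^(n + p) by stacking columns. *)
Definition graph_of (R : realType) (n p : nat) (g : 'cV[R]_n -> 'cV[R]_p) :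
    set 'cV[R]_(n + p) :=
  [set col_mx x (g x) | x in setT].

Definition second_subdiff (R : realType) (n : nat) (psi : 'cV[R]_n -> R)
    (xbar u : 'cV[R]_n) : set 'cV[R]_n :=
  [set w | limiting_normal_cone (graph_of (gradient psi))
             (col_mx xbar (gradient psi xbar)) (col_mx w (- u))].

(* Main.v *)
(* Every u tangent to the sparse set satisfies xbar + t u in S for all t: the
   support of xbar + t u is contained in the support of nearby sparse points.
   Hence xbar + t u is feasible for small t >= 0, and the mean value theorem
   gives theta -> 0+ with <u, grad f>(xbar + theta u) >= 0 = <u, grad f>(xbar).
   A mean value inequality for the Lipschitz function <u, grad f>, obtained by
   quadratic penalisation, then produces points c near xbar and proximal
   subgradients z of <u, grad f> at c that are bounded and almost satisfy
   <z, u> >= 0. Each (z, -u) is a Frechet normal to the graph of grad f, and a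
   cluster point of the z's is the required element. *)
Require Import Defs.
From HB Require Import structures.
From mathcomp Require Import all_boot all_order all_algebra.
From mathcomp Require Import all_classical all_reals all_analysis.
From mathcomp Require Import lra.
Import Order.TTheory GRing.Theory Num.Theory numFieldNormedType.Exports.
Local Open Scope classical_set_scope.
Local Open Scope ring_scope.

Set Implicit Arguments.
Unset Strict Implicit.
Unset Printing Implicit Defensive.

(** * Inner product algebra and comparison with the max norm *)

Lemma dotC (R : realType) n (u v : 'cV[R]_n) : dot u v = dot v u.
Proof. by apply: eq_bigr => i _; rewrite mulrC. Qed.

Lemma dotDl (R : realType) n (u v w : 'cV[R]_n) :
  dot (u + v) w = dot u w + dot v w.
Proof. by rewrite -big_split; apply: eq_bigr => i _; rewrite mxE mulrDl. Qed.

Lemma dotZl (R : realType) n (a : R) (u v : 'cV[R]_n) :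
  dot (a *: u) v = a * dot u v.
Proof. by rewrite mulr_sumr; apply: eq_bigr => i _; rewrite mxE mulrA. Qed.

Lemma dotNl (R : realType) n (u v : 'cV[R]_n) : dot (- u) v = - dot u v.
Proof. by rewrite -scaleN1r dotZl mulN1r. Qed.

Lemma dotDr (R : realType) n (u v w : 'cV[R]_n) :
  dot u (v + w) = dot u v + dot u w.
Proof. by rewrite dotC dotDl !(dotC u). Qed.

Lemma dotZr (R : realType) n (a : R) (u v : 'cV[R]_n) :
  dot u (a *: v) = a * dot u v.
Proof. by rewrite dotC dotZl (dotC u). Qed.

Lemma dotNr (R : realType) n (u v : 'cV[R]_n) : dot u (- v) = - dot u v.
Proof. by rewrite dotC dotNl (dotC u). Qed.

Lemma dot_ge0 (R : realType) n (u : 'cV[R]_n) : 0 <= dot u u.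
Proof. by apply: sumr_ge0 => i _; rewrite -expr2 sqr_ge0. Qed.

Lemma dot_col_mx (R : realType) n p (a c : 'cV[R]_n) (b d : 'cV[R]_p) :
  dot (col_mx a b) (col_mx c d) = dot a c + dot b d.
Proof.
rewrite /dot big_split_ord; congr (_ + _); apply: eq_bigr => i _.
  by rewrite !col_mxEu.
by rewrite !col_mxEd.
Qed.

Lemma normr_coord (R : realType) n (v : 'cV[R]_n) i : `|v i 0| <= `|v|.
Proof.
rewrite [leRHS]mx_normrE; apply/bigmax_geP; right.
by exists (i, 0).
Qed.

(** The max norm is attained at some coordinate, whose square is one term of the sum. *)
Lemma sqr_norm_le_dot (R : realType) n (v : 'cV[R]_n) : `|v| ^+ 2 <= dot v v.
Proof.
have [->|v0] := eqVneq v 0; first by rewrite normr0 expr0n dot_ge0.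
have [[i j] vij] : exists i, `|v| = `|v i.1 i.2|.
  by apply: mx_norm_neq0; rewrite -[mx_norm v]/(`|v|) normr_eq0.
rewrite vij.
rewrite ord1 /= real_normK ?num_real// /dot (bigD1 i)//= expr2 lerDl.
by apply: sumr_ge0 => k _; rewrite -expr2 sqr_ge0.
Qed.

Lemma norm_dot_le (R : realType) n (u v : 'cV[R]_n) :
  `|dot u v| <= n%:R * `|u| * `|v|.
Proof.
apply: le_trans (ler_norm_sum _ _ _) _.
rewrite -mulrA mulr_natl -[X in _ *+ X]card_ord -sumr_const.
by apply: ler_sum => i _; rewrite normrM ler_pM// normr_coord.
Qed.

(** * Continuity and compactness in column spaces *)

Lemma dot_continuous (R : realType) n (u : 'cV[R]_n) : continuous (dot u).
Proof.
apply: (@continuous_big R _ _ _ _ (@add_continuous R)) => i _ v.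
by apply: (@cvgM _ _ (nbhs v)); [exact: cvg_cst|exact: coord_continuous].
Qed.

Lemma dot_sq_continuous (R : realType) n :
  continuous (fun v : 'cV[R]_n => dot v v).
Proof.
apply: (@continuous_big R _ _ _ _ (@add_continuous R)) => i _ v.
by apply: (@cvgM _ _ (nbhs v)); exact: coord_continuous.
Qed.

Lemma col_mx_cvg (R : realType) n p (T : Type) (F : set_system T)
    (FF : Filter F) (x : T -> 'cV[R]_n) (y : T -> 'cV[R]_p)
    (a : 'cV[R]_n) (b : 'cV[R]_p) :
  x @ F --> a -> y @ F --> b -> col_mx (x t) (y t) @[t --> F] --> col_mx a b.
Proof.
move=> xa yb A [P Pnbhs PA].
suff : \forall t \near F, forall i, P i 0 (col_mx (x t) (y t) i 0).
  by apply: filterS => t Pt; apply: PA => i j; rewrite ord1.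
apply: filter_forall => i; move: (Pnbhs i 0).
case: (split_ordP i) => k ->; rewrite ?col_mxEu ?col_mxEd => H.
  have : \forall t \near F, P (lshift p k) 0 (x t k 0).
    exact: (xa _ (@coord_continuous R n 1 k 0 a _ H)).
  by apply: filterS => t; rewrite col_mxEu.
have : \forall t \near F, P (rshift n k) 0 (y t k 0).
  exact: (yb _ (@coord_continuous R p 1 k 0 b _ H)).
by apply: filterS => t; rewrite col_mxEd.
Qed.

(** A max-norm ball is a closed subset of a box; the box is the transpose of a product of segments,
    which [rV_compact] handles. *)
Lemma closed_ball_compact (R : realType) n (a : 'cV[R]_n) (r : R) :
  compact [set v : 'cV[R]_n | `|v - a| <= r].
Proof.
pose I i := `[a i 0 - r, a i 0 + r]%classic.
pose B := [set v : 'rV[R]_n | forall i, I i (v 0 i)].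
have Bc : compact B.
  by apply: (@rV_compact _ _ I) => i; exact: segment_compact.
have tc : continuous (@trmx R 1 n).
  move=> v A [P Pnbhs PA]; exists (fun i j => P j i) => [i j|w Pw].
    by have := Pnbhs j i; rewrite mxE.
  by apply: PA => i j; rewrite mxE; exact: Pw.
have tBc : compact (@trmx R 1 n @` B).
  by apply: continuous_compact => //; apply: continuous_subspaceT.
apply: subclosed_compact tBc _.
  apply: (@preimage_closed _ _ (fun v : 'cV[R]_n => `|v - a|)
    [set x | x <= r]); last exact: closed_le.
  move=> v _; apply: (@cvg_norm _ _ _ (nbhs v)).
  by apply: (@cvgB _ _ _ (nbhs v)); [exact: cvg_id|exact: cvg_cst].
move=> v vr; exists v^T; last exact: trmxK.
move=> i; rewrite /I/= in_itv/= -ler_distl mxE (le_trans _ vr)//.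
by have := normr_coord (v - a) i; rewrite !mxE.
Qed.

(** * Proximal normals and the penalised mean value inequality *)

(** The quadratic bound makes the quotient at most [K * enorm (q - p)], which vanishes as [q] tends
    to [p]. *)
Lemma frechet_of_proximal (R : realType) n (X : set 'cV[R]_n)
    (p v : 'cV[R]_n) (K : R) :
  (\forall q \near p, X q -> dot v (q - p) <= K * dot (q - p) (q - p)) ->
  frechet_normal_cone X p v.
Proof.
move=> near_p; rewrite /frechet_normal_cone /= limf_esupE.
apply/lee_addgt0Pr => e e0; rewrite add0e.
(* [K] may have any sign; [|K| + 1] is a positive bound for it. *)
have K0 : 0 < `|K| + 1 by rewrite ltr_wpDl.
have near_e : \forall q \near p, enorm (q - p) < e / (`|K| + 1).
  have : enorm (q - p) @[q --> p] --> (0 : R).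
    have <- : enorm (p - p) = 0.
      by rewrite subrr /enorm -(scale0r (0 : 'cV[R]_n)) dotZl mul0r sqrtr0.
    apply: (@continuous_comp _ _ _ (fun q : 'cV[R]_n => dot (q - p) (q - p))
      (@Num.sqrt R)); last exact: sqrt_continuous.
    apply: (@continuous_comp _ _ _ (fun q : 'cV[R]_n => q - p)
      (fun w : 'cV[R]_n => dot w w)).
      by apply: (@cvgB _ _ _ (nbhs p)); [exact: cvg_id|exact: cvg_cst].
    exact: dot_sq_continuous.
  by move=> /cvgr_lt; apply; rewrite divr_gt0.
apply: ge_ereal_inf; exists (ereal_sup ((fun x : 'cV[R]_n =>
  (dot v (x - p) / enorm (x - p))%:E) @`
  [set q | X q /\ dot v (q - p) <= K * dot (q - p) (q - p) /\
     enorm (q - p) < e / (`|K| + 1)])).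
  eexists; last reflexivity.
  rewrite /within /=; apply: nbhs_dnbhs.
  apply: filterS2 near_p near_e => q le1 le2 Xq.
  by split=> //; split=> //; exact: le1.
apply: ge_ereal_sup => _ [q [_ [le1 le2]] <-]; rewrite lee_fin.
(* The chosen set may contain [p] itself, where the quotient is 0 because [0^-1 = 0]. *)
have [/eqP ->|q0] := boolP (enorm (q - p) == 0).
  by rewrite invr0 mulr0 ltW.
have qpos : 0 < enorm (q - p) by rewrite lt_def q0 sqrtr_ge0.
rewrite ler_pdivrMr// (le_trans le1)//.
have -> : dot (q - p) (q - p) = enorm (q - p) * enorm (q - p).
  by rewrite -expr2 sqr_sqrtr// dot_ge0.
rewrite mulrA ler_pM2r//.
move: le2; rewrite ltr_pdivlMr// => /ltW; apply: le_trans.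
rewrite mulrC ler_pM2l//.
by rewrite (le_trans (ler_norm _))// lerDl.
Qed.

(* A minimiser (c, t) of g x + eps t + K |x - a - t u|^2 over the ball times
   [0, theta] provides z = - 2 K (c - a - t u); as t < theta, increasing t shows
   - eps <= <z, u>. *)
Lemma proximal_mean_value (R : realType) n (g : 'cV[R]_n -> R)
    (a u : 'cV[R]_n) (r L theta eps : R) :
  continuous g -> 0 < theta -> 0 < eps -> 0 < L -> theta * `|u| < r ->
  (forall x y, `|x - a| <= r -> `|y - a| <= r ->
    `|g x - g y| <= L * `|x - y|) ->
  g a <= g (a + theta *: u) ->
  exists c z K, [/\ `|c - a| < r, `|z| <= 2 * L, - eps <= dot z u &
    forall x, `|x - a| <= r ->
      g c + dot z (x - c) - K * dot (x - c) (x - c) <= g x].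
Proof.
move=> gc theta0 eps0 L0 ur lipg gab.
have r_gt : 0 < r - theta * `|u| by rewrite subr_gt0.
have et0 : 0 < eps * theta by rewrite mulr_gt0.
(* The first term of K keeps the minimiser off the face t = theta, the second
   keeps its first component inside the open ball. *)
pose K := L ^+ 2 / (eps * theta) + L / (r - theta * `|u|) + 1.
have K0 : 0 < K by rewrite /K ltr_wpDl ?addr_ge0 ?divr_ge0 ?ltW// exprn_gt0.
have K1 : L ^+ 2 / K < eps * theta.
  rewrite ltr_pdivrMr// -ltr_pdivrMl// mulrC /K -addrA ltrDl ltr_wpDl//.
  by rewrite divr_ge0// ltW.
have K2 : L / K < r - theta * `|u|.
  rewrite ltr_pdivrMr// -ltr_pdivrMl// mulrC /K addrAC ltrDr ltr_wpDl//.
  by rewrite divr_ge0 ?ltW// exprn_gt0.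
clearbody K.
pose y (p : 'cV[R]_n * R) := p.1 - (a + p.2 *: u).
pose H (p : 'cV[R]_n * R) := g p.1 + eps * p.2 + K * dot (y p) (y p).
have Hc : continuous H.
  move=> p; have c1 : fst @ nbhs p --> p.1 by exact: cvg_fst.
  have c2 : snd @ nbhs p --> p.2 by exact: cvg_snd.
  have yc : y @ nbhs p --> y p.
    apply: (@cvgB _ _ _ (nbhs p)) => //.
    apply: (@cvgD _ _ _ (nbhs p)); first exact: cvg_cst.
    by apply: (@cvgZr_tmp _ _ _ (nbhs p)).
  apply: (@cvgD _ _ _ (nbhs p)); last first.
    apply: (@cvgM _ _ (nbhs p)); first exact: cvg_cst.
    exact: (@cvg_comp _ _ _ y (fun v => dot v v) _ _ _ yc
      (@dot_sq_continuous R n (y p))).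
  apply: (@cvgD _ _ _ (nbhs p)).
    exact: (@cvg_comp _ _ _ fst g _ _ _ c1 (gc p.1)).
  by apply: (@cvgM _ _ (nbhs p)) => //; exact: cvg_cst.
pose C := [set x : 'cV[R]_n | `|x - a| <= r] `*` `[0, theta]%classic.
have Cc : compact C.
  by apply: compact_setX; [exact: closed_ball_compact|exact: segment_compact].
have segC t : 0 <= t <= theta -> `|a + t *: u - a| <= r.
  move=> /andP[t0 tt]; rewrite addrAC subrr add0r normrZ ger0_norm//.
  by rewrite (le_trans _ (ltW ur))// ler_wpM2r.
have theta00 : 0 <= (0 : R) <= theta by rewrite lexx ltW.
have Ca0 : C (a, 0).
  split; last by rewrite /= in_itv.
  by rewrite /= -[X in `|X - a|]addr0 -(scale0r u) segC.
have [|[c t] /set_mem [/= cr]] :=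
    @compact_EVT_min _ _ H C (ex_intro _ _ Ca0) Cc.
  exact: continuous_subspaceT.
rewrite in_itv/= => t0t minH.
have {}minH x t' : `|x - a| <= r -> 0 <= t' <= theta -> H (c, t) <= H (x, t').
  by move=> xr t'0; apply: minH; apply/mem_set; split => //=; rewrite in_itv.
have [w wE] : exists w, w = c - (a + t *: u) by eexists.
(* Comparison with [(a + t *: u, t)], where the penalty vanishes, gives [K * dot w w <= L * |w|]. *)
have Kw : K * `|w| <= L.
  have [->|w0] := eqVneq w 0; first by rewrite normr0 mulr0 ltW.
  have wpos : 0 < `|w| by rewrite normr_gt0.
  rewrite -(ler_pM2r wpos) -mulrA -expr2.
  apply: (@le_trans _ _ (K * dot w w)).
    by rewrite ler_pM2l// sqr_norm_le_dot.
  have := minH (a + t *: u) t (segC _ t0t) t0t.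
  rewrite /H /y /= subrr -wE -(scale0r (0 : 'cV[R]_n)) dotZl mul0r mulr0 addr0.
  have := lipg _ _ (segC _ t0t) cr.
  rewrite (distrC (a + _)) -wE => /(le_trans (ler_norm _)).
  lra.
have wL : `|w| <= L / K by rewrite ler_pdivlMr// mulrC.
have car : `|c - a| < r.
  have -> : c - a = w + t *: u by rewrite wE opprD addrA subrK.
  rewrite (le_lt_trans (ler_normD _ _))//.
  move: t0t => /andP[t0 tt].
  rewrite normrZ (ger0_norm t0).
  have : t * `|u| <= theta * `|u| by rewrite ler_wpM2r.
  lra.
(* If [t = theta], comparison with [(a, 0)] and [gab] give [eps * theta <= L * |w| <= L ^+ 2 / K],
   against [K1]. *)
have tlt : t < theta.
  case/andP: (t0t) => t0; rewrite le_eqVlt => /orP[/eqP tE|//].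
  exfalso.
  have thth : 0 <= theta <= theta by rewrite lexx ltW.
  have := lipg _ _ (segC _ thth) cr; rewrite (distrC (a + _)) -tE -wE tE.
  move=> /(le_trans (ler_norm _)).
  have := minH a 0 Ca0.1 theta00.
  rewrite /H /y /= -wE scale0r addr0 subrr -(scale0r (0 : 'cV[R]_n)) dotZl.
  have := dot_ge0 w; rewrite -(pmulr_rge0 _ K0).
  have : L * `|w| <= L ^+ 2 / K by rewrite expr2 -mulrA ler_pM2l.
  rewrite tE; lra.
(* Minus the gradient at [c] of the penalty in its first variable. *)
pose z := (- (2 * K)) *: w.
exists c, z, K; split => //.
- rewrite /z normrZ normrN ger0_norm; last by rewrite mulr_ge0// ltW.
  by rewrite -mulrA ler_pM2l.
- apply/ler_addgt0Pr => e e0.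
  (* Minimality against [(c, t + h)] reads [0 <= h * (eps + dot z u + h * K * dot u u)]; this [h]
     keeps [t + h] admissible and the last term at most [e]. The [+ 1] covers [u = 0]. *)
  pose h := Num.min (theta - t) (e / (K * dot u u + 1)).
  have Ku : 0 <= K * dot u u by rewrite mulr_ge0 ?dot_ge0// ltW.
  have h0 : 0 < h by rewrite lt_min subr_gt0 tlt divr_gt0// ltr_wpDl.
  have hth : 0 <= t + h <= theta.
    have : h <= theta - t by rewrite ge_min lexx.
    by move: t0t => /andP[t0 _]; lra.
  have he : h * (K * dot u u) <= e.
    have : h <= e / (K * dot u u + 1) by rewrite ge_min lexx orbT.
    rewrite ler_pdivlMr; last by rewrite ltr_wpDl.
    lra.
  have := minH c (t + h) cr hth; rewrite /H /y /= -wE.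
  have -> : c - (a + (t + h) *: u) = w + (- h) *: u.
    by rewrite wE scalerDl scaleNr addrA opprD addrA.
  rewrite (dotZl _ w u) dotDl !dotDr !dotZl !dotZr (dotC u w) => Hle.
  have : 0 <= h * (e + eps - 2 * K * dot w u) by nra.
  by rewrite pmulr_rge0//; lra.
(* With [t] fixed, expanding the square around [w] gives the proximal inequality. *)
move=> x xr; have := minH x t xr t0t; rewrite /H /y /= -wE.
have -> : x - (a + t *: u) = w + (x - c).
  by rewrite wE [RHS]addrC addrA subrK.
rewrite /z; move: (x - c) => d.
rewrite (dotZl _ w d) (dotDl w d) !(dotDr _ w d) (dotC d w); lra.
Qed.

(** For [x] near [c], the pairing of [(z, -u)] with the graph increment is at most [K] times the
    square of [x - c], hence at most [K] times the square of the whole increment, since [0 <= K]. *)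
Lemma frechet_graph_of_proximal (R : realType) n p
    (F : 'cV[R]_n -> 'cV[R]_p) (c z : 'cV[R]_n) (u : 'cV[R]_p) (K : R) :
  0 <= K ->
  (\forall x \near c, dot u (F c) + dot z (x - c) - K * dot (x - c) (x - c)
     <= dot u (F x)) ->
  frechet_normal_cone (graph_of F) (col_mx c (F c)) (col_mx z (- u)).
Proof.
move=> K0 nearc; apply: (@frechet_of_proximal _ _ _ _ _ K).
(* Continuity of the projection pulls the neighbourhood of [c] back to one of the graph point;
   lower-block coordinates are left free by [setT]. *)
have uc : continuous (@usubmx R n p 1).
  move=> v A [P Pnbhs PA].
  exists (fun i j => if fintype.split i is inl k then P k j else setT) => [i j|w Pw].
    case: fintype.splitP => k ik; last exact: filterT.
    have -> : i = lshift p k by exact: val_inj.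
    by have := Pnbhs k j; rewrite mxE.
  apply: PA => i j; rewrite mxE; have := Pw (lshift p i) j.
  by rewrite (unsplitK (inl i)).
have := uc (col_mx c (F c)); rewrite /continuous_at col_mxKu => ucc.
have : \forall q \near col_mx c (F c), 
  dot u (F c) + dot z (usubmx q - c) - K * dot (usubmx q - c) (usubmx q - c) <=
  dot u (F (usubmx q)) by exact: (ucc _ nearc).
apply: filterS => q + [x _ xq]; rewrite -xq col_mxKu => le_x.
rewrite opp_col_mx add_col_mx !dot_col_mx dotNl (dotDr u) dotNr.
have : 0 <= K * dot (F x - F c) (F x - F c) by rewrite mulr_ge0 ?dot_ge0.
lra.
Qed.

(** * Feasible segments in the sparse set *)

(** For one large [k], [x + t k *: v k] is nonzero wherever [x + tau *: u] is: on the support of [x]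
    by convergence to [x], and off it, where [u] is nonzero, because the coordinate is [t k] times
    one tending to that of [u]. *)
Lemma sparse_segment (R : realType) n s (x u : 'cV[R]_n) :
  contingent_cone (sparse s) x u -> forall t : R, sparse s (x + t *: u).
Proof.
move=> [t [v [t0 tcvg vcvg Xs]]] tau.
have coordcvg i : x i 0 + t k * v k i 0 @[k --> \oo] --> x i 0.
  rewrite -[X in _ --> X]addr0 -[X in _ --> _ + X](mul0r (u i 0)).
  apply: cvgD; first exact: cvg_cst.
  apply: cvgM => //.
  exact: (cvg_comp _ _ vcvg (@coord_continuous R n 1 i 0 u)).
have near_supp i : \forall k \near \oo,
    (x + tau *: u) i 0 != 0 -> (x + t k *: v k) i 0 != 0.
  have [x0|x0] := eqVneq (x i 0) 0; last first.
    have nz := @cvgr_neq0 _ _ _ \oo eventually_filter _ _ (coordcvg i) x0.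
    by apply: filterS nz => k; rewrite !mxE.
  have [u0|u0] := eqVneq (u i 0) 0.
    by near=> k; rewrite !mxE x0 u0 mulr0 addr0 eqxx.
  have vi : v k i 0 @[k --> \oo] --> u i 0.
    exact: (cvg_comp _ _ vcvg (@coord_continuous R n 1 i 0 u)).
  have nz := @cvgr_neq0 _ _ _ \oo eventually_filter _ _ vi u0.
  by apply: filterS nz => k vk _; rewrite !mxE x0 add0r mulf_neq0// gt_eqF.
have : \forall k \near \oo, forall i,
    (x + tau *: u) i 0 != 0 -> (x + t k *: v k) i 0 != 0.
  exact: filter_forall.
move=> [N _ /(_ N (leqnn N)) HN].
rewrite /sparse /= (leq_trans _ (Xs N))//.
by apply: subset_leq_card; apply/fintype.subsetP => i; rewrite !inE; exact: HN.
Unshelve. all: by end_near. Qed.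

(** * First-order calculus along lines and the local Lipschitz bound *)

Lemma derive_gradient (R : realType) n (f : 'cV[R]_n -> R) (x u : 'cV[R]_n) :
  differentiable f x -> 'D_u f x = dot (gradient f x) u.
Proof.
move=> fx; rewrite deriveE//.
have {1}-> : u = \sum_(i < n) u i 0 *: delta_mx i 0.
  rewrite [LHS]matrix_sum_delta; apply: eq_bigr => i _.
  by rewrite big_ord1.
rewrite linear_sum; apply: eq_bigr => i _.
by rewrite linearZ /= mxE deriveE// mulrC.
Qed.

Lemma is_derive_line (R : realType) n (f : 'cV[R]_n -> R) (a u : 'cV[R]_n)
    (t : R) :
  differentiable f (a + t *: u) ->
  is_derive t 1 (fun t => f (a + t *: u)) (dot (gradient f (a + t *: u)) u).
Proof.
move=> fx; rewrite -derive_gradient//.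
(* Difference quotients of the restriction to the line are those of [f] in direction [u]. *)
have E : (fun h : R => h^-1 *: (((fun t => f (a + t *: u)) \o shift t) (h *: 1)
      - f (a + t *: u))) =
    (fun h => h^-1 *: ((f \o shift (a + t *: u)) (h *: u) - f (a + t *: u))).
  apply/funext => h /=; congr (_ *: (f _ - _)).
  by rewrite -[h *: 1]/(h * 1) mulr1 scalerDl addrCA.
have d : derivable f (a + t *: u) u by exact: diff_derivable.
apply: DeriveDef; first by rewrite /derivable E.
by rewrite /derive E.
Qed.

Lemma ascent_point (R : realType) n (f : 'cV[R]_n -> R) (a u : 'cV[R]_n)
    (tau : R) :
  0 < tau -> (forall x, differentiable f x) -> f a <= f (a + tau *: u) ->
  exists2 theta, 0 < theta < tau & 0 <= dot (gradient f (a + theta *: u)) u.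
Proof.
move=> tau0 df fa.
have D (t : R) := @is_derive_line R n f a u t (df _).
have lc : {within `[0, tau], continuous (fun t : R => f (a + t *: u))}.
  apply: derivable_within_continuous => t _.
  exact: (@ex_derive _ _ _ _ _ _ _ (D t)).
have [theta] := MVT tau0 (fun t _ => D t) lc.
rewrite in_itv/= => thetaI E; exists theta => //.
have : 0 <= dot (gradient f (a + theta *: u)) u * (tau - 0).
  by rewrite -E scale0r addr0 subr_ge0.
by rewrite subr0 pmulr_lge0.
Qed.

Lemma class_C11_lipschitz_ball (R : realType) n (f : 'cV[R]_n -> R)
    (a : 'cV[R]_n) :
  class_C11_around f a ->
  exists r L : R, [/\ 0 < r, 0 < L &
    forall x y, `|x - a| <= r -> `|y - a| <= r ->
      `|gradient f x - gradient f y| <= L * `|x - y|].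
Proof.
move=> [U [_ Ua _ /(_ a Ua)[V aV lipV]]].
have [r r0 rV] : exists2 r : R, 0 < r & forall x, `|x - a| <= r -> V x.
  have [e /= e0 eV] := (@nbhs_ballP R _ a V).1 aV.
  exists (e / 2); first by rewrite divr_gt0.
  move=> x xa; apply: eV; rewrite -ball_normE /= distrC.
  by rewrite (le_lt_trans xa)// ltr_pdivrMr// ltr_pMr// ltr1n.
have [L [L0 HL]] : exists L : R, 0 < L /\
    L.-lipschitz_V (gradient f).
  (* The Lipschitz property holds for all large constants, so a positive one can be picked. *)
  near (+oo : set_system R) => L; exists L; split; near: L => //.
  exact: nbhs_pinfty_gt.
exists r, L; split=> // x y xr yr.
by apply: (HL (x, y)); split; exact: rV.
Unshelve. all: by end_near. Qed.

(** * Passage to the limiting normal cone *)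

(** Taking [e = 1 / (k + 1)], the base points tend to [a], their gradients converge by continuity,
    and the bounded [z] have a cluster point. *)
Lemma second_subdiff_limit (R : realType) n (f : 'cV[R]_n -> R)
    (a u : 'cV[R]_n) (M : R) :
  continuous (gradient f) ->
  (forall e : R, 0 < e -> exists c z, [/\ `|c - a| < e, `|z| <= M,
    - e <= dot z u &
    frechet_normal_cone (graph_of (gradient f)) (col_mx c (gradient f c))
      (col_mx z (- u))]) ->
  exists2 z, second_subdiff f a u z & 0 <= dot z u.
Proof.
move=> Fc H.
have /choice[cz Hcz] : forall k : nat, exists cz : 'cV[R]_n * 'cV[R]_n,
    [/\ `|cz.1 - a| < k.+1%:R^-1, `|cz.2| <= M, - k.+1%:R^-1 <= dot cz.2 u &
    frechet_normal_cone (graph_of (gradient f))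
      (col_mx cz.1 (gradient f cz.1)) (col_mx cz.2 (- u))].
  by move=> k; have [|c [z ?]] := H k.+1%:R^-1 => //; exists (c, z).
pose zs k := (cz k).2.
have [|z [_ zcl]] := @closed_ball_compact R n 0 M (zs @ \oo) _.
  by exists 0%N => // k _ /=; rewrite subr0; have [] := Hcz k.
(* Indices [j k >= k], monotone or not, suffice: all errors at [j k] are bounded by
   [1 / (k + 1)]. *)
have /choice[j Hj] : forall k : nat, exists j, (k <= j)%N /\
    `|zs j - z| < k.+1%:R^-1.
  move=> k.
  have [||v [[i ki <-] zi]] := zcl (zs @` [set i | (k <= i)%N])
      (ball z k.+1%:R^-1).
  - by exists k => // i ki; exists i.
  - by apply: nbhsx_ballx; rewrite invr_gt0.
  by exists i; split => //; rewrite distrC; move: zi; rewrite -ball_normE.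
have harm : (fun k : nat => k.+1%:R^-1 : R) @ \oo --> (0 : R).
  exact: cvg_harmonic.
have le_harm k : (j k).+1%:R^-1 <= k.+1%:R^-1 :> R.
  by rewrite lef_pV2 ?posrE// ler_nat ltnS; have [] := Hj k.
have xcvg : (fun k => (cz (j k)).1) @ \oo --> a.
  apply/cvgrPdist_lt => e e0; near=> k; rewrite distrC.
  have [/lt_le_trans/(_ (le_harm k))/lt_trans + _ _ _] := Hcz (j k); apply.
  by near: k; apply: (cvgr_lt _ harm).
have zcvg : (fun k => zs (j k)) @ \oo --> z.
  apply/cvgrPdist_lt => e e0; near=> k; rewrite distrC.
  have [_ /lt_trans] := Hj k; apply.
  by near: k; apply: (cvgr_lt _ harm).
exists z.
  exists (fun k => col_mx (cz (j k)).1 (gradient f (cz (j k)).1)).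
  exists (fun k => col_mx (zs (j k)) (- u)); split.
  - by move=> k; exists (cz (j k)).1.
  - apply: col_mx_cvg => //.
    exact: (cvg_comp _ _ xcvg (Fc a)).
  - by move=> k; have [] := Hcz (j k).
  - by apply: col_mx_cvg => //; exact: cvg_cst.
have dcvg : (fun k => dot u (zs (j k))) @ \oo --> dot u z.
  exact: (cvg_comp _ _ zcvg (@dot_continuous R n u z)).
have hN : (fun k : nat => - k.+1%:R^-1 : R) @ \oo --> (0 : R).
  by rewrite -oppr0; apply: cvgN.
rewrite dotC; apply: (ler_cvg_to hN dcvg); near=> k.
rewrite (le_trans _ (_ : - (j k).+1%:R^-1 <= _))//.
  by rewrite lerN2.
by rewrite dotC; have [] := Hcz (j k).
Unshelve. all: by end_near. Qed.

(** * The second-order necessary condition *)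

Unset Implicit Arguments.
Set Strict Implicit.
Set Printing Implicit Defensive.

Theorem theorem3p3 (R : realType) (n m s : nat)
    (hn : (1 <= n)%N) (hm : (1 <= m)%N) (hs : (0 < s < n)%N)
    (f : 'cV[R]_n -> R) (hf : class_C1 f)
    (A : 'M[R]_(m, n)) (b : 'cV[R]_m)
    (phi : 'cV[R]_n -> 'cV[R]_m) (hphi : forall x, phi x = A *m x + b)
    (D : set 'cV[R]_m) (hDclosed : closed D)
    (hDconvex : convex_set (D : set (convex_lmodType 'cV[R]_m)))
    (hDcone : cone D)
    (xbar : 'cV[R]_n) (hxbar0 : xbar <> 0)
    (hopt : local_optimal_solution f (phi @^-1` D `&` sparse s) xbar)
    (hC11 : class_C11_around f xbar) :
  forall u : 'cV[R]_n,
    radial_cone (phi @^-1` D) xbar u -> contingent_cone (sparse s) xbar u ->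
    dot (gradient f xbar) u = 0 ->
  exists2 z : 'cV[R]_n, second_subdiff f xbar u z & 0 <= dot z u.
Proof.
move=> u [tau tau0 Phi_u] /sparse_segment S_u grad_u.
have [df Fc] := hf; have [_ fmin] := hopt.
have [r [L [r0 L0 lipF]]] := class_C11_lipschitz_ball hC11.
(* A Lipschitz constant for the pairing of [u] with the gradient, by [norm_dot_le]; [+ 1] makes it
   positive even when [u = 0]. *)
pose L' := n%:R * `|u| * L + 1.
have L'0 : 0 < L' by rewrite ltr_wpDl// !mulr_ge0// ltW.
apply: (@second_subdiff_limit _ _ _ _ _ (2 * L')) => // e e0.
(* Within [rho] of [xbar], points are [e]-close and the gradient is Lipschitz. *)
pose rho := Num.min e r.
have rho0 : 0 < rho by rewrite lt_min e0.
have rho_r : rho <= r by rewrite ge_min lexx orbT.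
have u1 : 0 < `|u| + 1 by rewrite ltr_wpDl.
have [t [t0 t_tau t_rho ft]] : exists t : R,
    [/\ 0 < t, t <= tau, t * (`|u| + 1) < rho & f xbar <= f (xbar + t *: u)].
  have [d /= d0 dmin] := (@nbhs_ballP R _ xbar _).1 fmin.
  (* Halving makes the bounds strict: the endpoint lies in the ball of local optimality, and the
     segment in the [rho]-ball. *)
  pose q := Num.min d rho / (`|u| + 1) / 2.
  have q0 : 0 < q by rewrite !divr_gt0// lt_min d0.
  exists (Num.min tau q).
  have t0 : 0 < Num.min tau q by rewrite lt_min tau0.
  have tq : Num.min tau q * (`|u| + 1) < Num.min d rho.
    rewrite -ltr_pdivlMr//.
    have : Num.min tau q <= q by rewrite ge_min lexx orbT.
    rewrite /q; move: q0; rewrite /q; lra.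
  move: tq; rewrite lt_min => /andP[td trho].
  have ttau : Num.min tau q <= tau by rewrite ge_min lexx.
  split => //; apply: dmin; last first.
    by split; [apply: Phi_u; rewrite ltW|exact: S_u].
  rewrite -ball_normE /= opprD addrA subrr add0r normrN normrZ gtr0_norm//.
  by rewrite (le_lt_trans _ td)// ler_pM2l// lerDl.
have [theta /andP[th0 tht] ascent] := ascent_point t0 df ft.
pose g x := dot u (gradient f x).
have gc : continuous g.
  move=> x; apply: (@cvg_comp _ _ _ (gradient f) (dot u) _ _ _ (Fc x)).
  exact: dot_continuous.
have glip x y : `|x - xbar| <= rho -> `|y - xbar| <= rho ->
    `|g x - g y| <= L' * `|x - y|.
  move=> /le_trans/(_ rho_r) xr /le_trans/(_ rho_r) yr.
  rewrite /g -dotNr -dotDr (le_trans (norm_dot_le _ _))//.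
  apply: (@le_trans _ _ (n%:R * `|u| * (L * `|x - y|))).
    by rewrite ler_wpM2l ?mulr_ge0//; exact: lipF.
  by rewrite mulrA ler_wpM2r// /L' lerDl.
have th_rho : theta * `|u| < rho.
  apply: le_lt_trans t_rho; apply: ler_pM => //; [exact: ltW|exact: ltW|].
  by rewrite lerDl.
(* The left side is 0 by [grad_u]; the right side is nonnegative by [ascent]. *)
have gth : g xbar <= g (xbar + theta *: u).
  by rewrite /g dotC grad_u dotC.
have [c [z [K [c_rho zL zu prox]]]] :=
  proximal_mean_value gc th0 e0 L'0 th_rho glip gth.
exists c, z; split => //.
  by rewrite (lt_le_trans c_rho)// ge_min lexx.
(* [K] comes without a sign; passing to its absolute value only weakens the proximal inequality.
   That inequality holds near [c] because [c] is interior to the [rho]-ball. *)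
apply: (@frechet_graph_of_proximal _ _ _ _ _ _ _ `|K|) => //.
have : \forall x \near c, `|x - xbar| < rho.
  have : `|x - xbar| @[x --> c] --> `|c - xbar|.
    apply: (@cvg_norm _ _ _ (nbhs c)).
    by apply: (@cvgB _ _ _ (nbhs c)); [exact: cvg_id|exact: cvg_cst].
  by move=> /cvgr_lt; apply.
apply: filterS => x /ltW /prox; apply: le_trans.
by rewrite lerD2l lerN2 ler_wpM2r ?dot_ge0// ler_norm.
Qed.
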